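(* Let $I=[0,1]$ and let $T_1,\dots,T_k\colon I\to I$ ($k\ge2$) be continuous maps. Suppose that there is some non-trivial closed interval $J\subset I$ such that $T_i(J)\subset J$ and $T_i|_J$ is injective for every $i\in\{1,\dots,k\}$. Then the following assertions are equivalent: (1) The maps $T_1,\dots,T_k$ have no common fixed point and $S_{\mathrm t}\ne\emptyset$. (2) The target set $A_{\mathrm t}$ has at least two elements. (3) There are finite sequences $\xi_1\dots\xi_\ell$ and $\omega_1\dots\omega_s$ in $\{1,\dots,k\}$ such that $$T_{\xi_1}\circ\cdots\circ T_{\xi_\ell}(I)\cap T_{\omega_1}\circ\cdots\circ T_{\omega_s}(I)=\emptyset\quad\text{and}\quad T_{\xi_1}\circ\cdots\circ T_{\xi_\ell}(I)\cup T_{\omega_1}\circ\cdots\circ T_{\omega_s}(I)\subset J.$$ (4) The maps $T_1,\dots,T_k$ have no common fixed point and $\mathbb P^+(S_{\mathrm t})=1$ for every mixing Markov measure $\mathbb P^+$ whose support is the whole $\Sigma_k^+$.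
   Context: $\Sigma_k^+=\{1,\dots,k\}^{\mathbb N}$ with left shift $\sigma(\xi)_n=\xi_{n+1}$, and cylinders $[a_0\dots a_\ell]=\{\omega\in\Sigma_k^+:\omega_0=a_0,\dots,\omega_\ell=a_\ell\}$. The set of weakly hyperbolic sequences is $S_{\mathrm t}=\{\xi\in\Sigma_k^+ : \lim_{n\to\infty}\mathrm{diam}(T_{\xi_0}\circ\cdots\circ T_{\xi_n}(I))=0\}$. The coding map $\pi\colon S_{\mathrm t}\to I$ is $\pi(\xi)=\lim_{n\to\infty}T_{\xi_0}\circ\cdots\circ T_{\xi_n}(p)$, which does not depend on $p\in I$. The target set is $A_{\mathrm t}=\pi(S_{\mathrm t})$. No common fixed point means there is no $x\in I$ with $T_i(x)=x$ for all $i$. A transition matrix is a $k\times k$ matrix $P=(p_{ij})$ with $p_{ij}\ge0$ and $\sum_jp_{ij}=1$ for every $i$. It is irreducible if for all $\ell,r$ some power $P^n$ has positive $(\ell,r)$ entry; it then has a unique stationary probability vector $\bar p=(p_1,\dots,p_k)$, $\bar pP=\bar p$. The Markov measure $\mathbb P^+$ associated to an irreducible transition matrix $P$ (and $\bar p$) is the Borel probability on $\Sigma_k^+$ with $\mathbb P^+([a_0\dots a_\ell])=p_{a_0}p_{a_0a_1}\cdots p_{a_{\ell-1}a_\ell}$. It is mixing if $\lim_{n\to\infty}\mathbb P^+(\sigma^{-n}(A)\cap B)=\mathbb P^+(A)\mathbb P^+(B)$ for all Borel $A,B$. *)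

(* Defs.v *)
From HB Require Import structures.
From mathcomp Require Import all_boot all_order all_algebra.
From mathcomp Require Import all_classical all_reals all_analysis.

Set Implicit Arguments.
Unset Strict Implicit.
Unset Printing Implicit Defensive.

Import Order.TTheory GRing.Theory Num.Theory.
Import numFieldNormedType.Exports.

Local Open Scope classical_set_scope.
Local Open Scope ring_scope.

(* A measurable type must be inhabited, hence the alphabet 'I_k.+1. *)
Definition shift_space (k : nat) : Type :=
  prod_topology (fun _ : nat => discrete_topology 'I_k.+1).

HB.instance Definition _ (k : nat) := Topological.on (shift_space k).
HB.instance Definition _ (k : nat) :=
  isPointed.Build (shift_space k) (fun=> ord0).

Definition borel_shift_space (k : nat) :=
  g_sigma_algebraType (@open (shift_space k)).

Definition shift (k : nat) (xi : shift_space k) : shift_space k :=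
  fun n => xi n.+1.

Definition prefix_word (k : nat) (xi : shift_space k) (n : nat) : seq 'I_k.+1 :=
  mkseq (fun i => xi i : 'I_k.+1) n.

Definition cylinder (k : nat) (a : seq 'I_k.+1) : set (shift_space k) :=
  [set xi | prefix_word xi (size a) = a].

Definition unit_interval (R : realType) : set R := `[0%R, 1%R]%classic.
Arguments unit_interval : clear implicits.

Definition diam (R : realType) (A : set R) : R :=
  sup [set `|x - y| | x in A & y in A].

Section iterated_maps.
Context (R : realType) (k : nat).
Implicit Types (T : 'I_k.+1 -> R -> R) (s : seq 'I_k.+1) (xi : shift_space k).

(* The first letter of the word is the outermost map:
   word_map T [:: i; j] x = T i (T j x). *)
Definition word_map T s (x : R) : R := foldr T x s.

Definition weakly_hyperbolic T : set (shift_space k) :=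
  [set xi | (fun n => diam (word_map T (prefix_word xi n.+1)
                              @` unit_interval R)) @ \oo --> (0 : R)].

(* On weakly hyperbolic sequences the base point 0 can be replaced with any
   point of the unit interval: see coding_cvg. *)
Definition coding T xi : R :=
  lim ((fun n => word_map T (prefix_word xi n.+1) 0) @ \oo).

Definition target T : set R := coding T @` weakly_hyperbolic T.

Definition no_common_fixed_point T : Prop :=
  ~ exists2 x, unit_interval R x & forall i, T i x = x.

Lemma word_map_unit T (hT : forall i, T i @` unit_interval R `<=` unit_interval R)
    s (x : R) :
  unit_interval R x -> unit_interval R (word_map T s x).
Proof. by move=> x01; elim: s => //= i s IH; apply: (hT i); exists (word_map T s x). Qed.

Lemma word_map_cat T s1 s2 (x : R) :
  word_map T (s1 ++ s2) x = word_map T s1 (word_map T s2 x).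
Proof. exact: foldr_cat. Qed.

Lemma prefix_word_split xi (m n : nat) : (n <= m)%N ->
  exists s, prefix_word xi m = prefix_word xi n ++ s.
Proof.
move=> nm; exists (map (fun i => xi i : 'I_k.+1) (iota n (m - n))).
by rewrite -map_cat -iotaD subnKC.
Qed.

Lemma dist_le_diam (A : set R) (x y : R) : A `<=` unit_interval R ->
  A x -> A y -> `|x - y| <= diam A.
Proof.
move=> A01 Ax Ay; apply: ub_le_sup; last by exists x => //; exists y.
exists 1 => _ [u /A01 + [v /A01 +] <-]; rewrite /unit_interval /= !in_itv/=.
move=> /andP[u0 u1] /andP[v0 v1]; rewrite ler_norml; apply/andP; split.
  by rewrite lerBrDl (le_trans _ u0)// subr_le0.
by rewrite lerBlDr (le_trans u1)// lerDl.
Qed.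

Lemma coding_cvg T (hT : forall i, T i @` unit_interval R `<=` unit_interval R)
    xi (p : R) : weakly_hyperbolic T xi -> unit_interval R p ->
  (fun n => word_map T (prefix_word xi n.+1) p) @ \oo --> coding T xi.
Proof.
move=> hxi p01.
have z01 : unit_interval R 0 by rewrite /unit_interval /= in_itv /= lexx ler01.
pose u q n := word_map T (prefix_word xi n.+1) q.
have uB (q r : R) n m : (n <= m)%N -> unit_interval R q -> unit_interval R r ->
    `|u q n - u r m| <= diam (word_map T (prefix_word xi n.+1) @` unit_interval R).
  move=> nm q01 r01; apply: dist_le_diam.
  - by move=> _ [v v01 <-]; exact: word_map_unit.
  - by exists q.
  - have [s es] := @prefix_word_split xi m.+1 n.+1 nm.
    exists (word_map T s r); first exact: word_map_unit.
    by rewrite -word_map_cat -es.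
have cu : cvg (u 0 @ \oo).
  apply: cauchy_cvg.
  apply/cauchy_exP => e e0.
  have /cvgrPdist_lt/(_ _ e0)[N _ /(_ N (leqnn N))] := hxi.
  rewrite /= sub0r normrN => hN.
  exists (u 0 N); exists N => // m /= Nm.
  by rewrite -ball_normE /=; apply: le_lt_trans (uB 0 0 N m Nm z01 z01) (le_lt_trans (ler_norm _) hN).
have c0 : u 0 @ \oo --> coding T xi by exact: cu.
apply/cvgrPdist_lt => e e0.
have e20 : 0 < e / 2 by rewrite divr_gt0.
have /cvgrPdist_lt/(_ _ e20) d1 := c0.
have /cvgrPdist_lt/(_ _ e20) d2 := hxi.
near=> n.
rewrite (_ : _ - _ = (coding T xi - u 0 n) + (u 0 n - u p n)); last first.
  by rewrite addrA subrK.
rewrite (splitr e) (le_lt_trans (ler_normD _ _))// ltrD//.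
  by near: n.
apply: (le_lt_trans (uB 0 p n n (leqnn n) z01 p01)).
apply: (le_lt_trans (ler_norm _)).
rewrite -[X in `|X|]opprK normrN -sub0r.
by near: n.
Unshelve. all: by end_near. Qed.

End iterated_maps.

Section markov_measures.
Context (R : realType) (k : nat).
Implicit Types (P : 'M[R]_k.+1) (p : 'rV[R]_k.+1).

Definition transition_matrix P : Prop :=
  (forall i j, 0 <= P i j) /\ (forall i, \sum_j P i j = 1).

Definition irreducible_matrix P : Prop :=
  forall l r, exists2 n, (0 < n)%N & 0 < (P ^+ n) l r.

Definition stationary_vector P p : Prop :=
  [/\ forall i, 0 <= p 0 i, \sum_i p 0 i = 1 & p *m P = p].

(* zip drops the last letter of a0 :: s, so the product runs over the pairs of
   consecutive letters of a0 :: s. *)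
Definition markov_measure (mu : probability (borel_shift_space k) R) : Prop :=
  exists P p, [/\ transition_matrix P, irreducible_matrix P,
    stationary_vector P p &
    forall a0 s, mu (cylinder (a0 :: s)) =
      (p 0 a0 * \prod_(b <- zip (a0 :: s) s) P b.1 b.2)%:E].

Definition mixing (mu : probability (borel_shift_space k) R) : Prop :=
  forall A B : set (borel_shift_space k), measurable A -> measurable B ->
    (fun n => mu ((iter n (@shift k) @^-1` A) `&` B)) @ \oo
      --> (mu A * mu B)%E.

Definition measure_support (mu : probability (borel_shift_space k) R)
    : set (shift_space k) :=
  [set xi | forall U : set (shift_space k), open U -> U xi -> (0 < mu U)%E].

End markov_measures.

(* Main.v *)
From HB Require Import structures.
Require Import Defs.
From mathcomp Require Import all_boot all_order all_algebra.
From mathcomp Require Import all_classical all_reals all_analysis.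
From mathcomp Require Import lra.

(** Write A_n(xi) for the image of the unit interval under the word formed by
    the first n letters of xi. These are nested intervals, and xi is weakly
    hyperbolic with code x exactly when they shrink to the point x
    ([weakly_hyperbolic_shrinks], [shrinks_weakly_hyperbolic]).

    (1) implies (2). If A_n(xi) shrinks to x, then putting the letter i in front
    of xi gives a sequence shrinking to T_i x, by continuity. So the target set
    is invariant ([target_invariant]), and a target point that is not fixed by
    some T_i provides a second one.

    (2) implies (3). It suffices to find two distinct target points in the
    interior of J, since words shrinking to them have disjoint images inside J.
    If all target points were endpoints of J, both endpoints would be target
    points and every word would permute them, so no image could be small
    ([target_interior]). An interior target point z stays interior under the
    maps, which are strictly monotone on J ([T_interior]), and it is moved by
    one of them, because a common fixed point belongs to all the A_n(xi) and
    would be the only target point.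

    (3) implies (4). A common fixed point would lie in both images. For the
    measure, let u and v be words with disjoint images inside J. Every word w
    acts injectively on J, so the images of w u v and w v u are disjoint as
    well: a given point q is missed after at least one of two continuations of w
    of the same length ([word_image_splitting]). A Markov measure of full
    support has a positive transition matrix, so this continuation has
    conditional probability at least some d > 0 that depends neither on w nor on
    q ([markov_full_support_lower_bound]). Hence the probability that q lies in
    A_n(xi) decays geometrically, and almost surely no rational point lies in
    all the A_n(xi). A nested sequence of intervals whose diameters do not tend
    to 0 has at least two common rational points ([weakly_hyperbolicE]), so
    almost every xi is weakly hyperbolic.

    (4) implies (1). One needs a mixing Markov measure of full support to which
    (4) can be applied. The uniform Bernoulli measure is such a measure; it is
    obtained as the distribution of the base-(k+1) digits of a uniform point of
    the interval [0, 1[ ([bernoulli_shift]). It is mixing because, for every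
    Borel set A, the n-th preimage of A under the shift is independent of all
    events that depend on the first n letters only; these events generate the
    Borel sets, and the sets B that satisfy the mixing limit form a Dynkin
    system ([mixing_bernoulli_shift]). *)

Set Implicit Arguments.
Unset Strict Implicit.
Unset Printing Implicit Defensive.

Import Order.TTheory GRing.Theory Num.Theory.
Import numFieldNormedType.Exports.

Local Open Scope classical_set_scope.
Local Open Scope ring_scope.

(** * Cylinders and the topology of the shift space *)

Section shift_space.
Context (k : nat).
Implicit Types (xi eta : shift_space k) (w a : seq 'I_k.+1).

Lemma prefix_wordP xi eta n :
  (prefix_word xi n = prefix_word eta n) <-> (forall i, (i < n)%N -> xi i = eta i).
Proof.
split=> [h i ltin|h].
  by have := congr1 (fun s => nth ord0 s i) h; rewrite !nth_mkseq.
by apply/eq_in_map => i; rewrite mem_iota => /h.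
Qed.

Lemma size_prefix_word xi n : size (prefix_word xi n) = n.
Proof. exact: size_mkseq. Qed.

Lemma cylinder_prefixP xi eta n :
  cylinder (prefix_word xi n) eta <-> (forall i, (i < n)%N -> eta i = xi i).
Proof.
by rewrite -prefix_wordP /cylinder [X in X <-> _]/= size_prefix_word.
Qed.

Lemma cylinder_prefix xi n : cylinder (prefix_word xi n) xi.
Proof. by rewrite /cylinder /= size_prefix_word. Qed.

Lemma iter_shiftE xi n i : iter n (@Defs.shift k) xi i = xi (n + i)%N.
Proof. by elim: n i => //= n IH i; rewrite /Defs.shift IH addSnnS. Qed.

Lemma prefix_wordD xi m n :
  prefix_word xi (m + n) = prefix_word xi m ++ prefix_word (iter m (@Defs.shift k) xi) n.
Proof.
rewrite /prefix_word /mkseq iotaD map_cat; congr (_ ++ _).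
rewrite add0n -[in LHS](addn0 m) iotaDl -map_comp.
by apply: eq_map => i /=; rewrite iter_shiftE.
Qed.

Lemma cylinder_cat a w :
  cylinder (a ++ w) = cylinder a `&` iter (size a) (@Defs.shift k) @^-1` cylinder w.
Proof.
apply/seteqP; split=> xi; rewrite /cylinder /= size_cat prefix_wordD.
  by move/eqP; rewrite eqseq_cat ?size_prefix_word// => /andP[/eqP ? /eqP].
by case=> -> ->.
Qed.

Lemma open_cylinder a : open (cylinder a).
Proof.
elim/last_ind: a => [|a i IH].
  by rewrite (_ : cylinder _ = setT); [exact: openT|apply/seteqP; split].
have -> : cylinder (rcons a i) =
    cylinder a `&` proj (size a) @^-1` [set i : discrete_topology 'I_k.+1].
  apply/seteqP; split=> xi; rewrite /cylinder /= size_rcons /prefix_word mkseqS.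
    by move=> /rcons_inj[? ?]; split.
  by rewrite /proj => -[-> ->].
apply: openI => //; apply: open_comp; last exact: discrete_open.
by move=> xi _; exact: proj_continuous.
Qed.

(** The sets containing a cylinder around [xi] form a filter; it converges to
    [xi] because each coordinate is determined by a long enough prefix. *)
Lemma nbhs_cylinder xi (U : set (shift_space k)) : open U -> U xi ->
  exists n, cylinder (prefix_word xi n) `<=` U.
Proof.
move=> oU Uxi.
pose F := filter_from [set: nat] (fun n => cylinder (prefix_word xi n)).
have FF : Filter F.
  apply: filter_from_filter; first by exists 0%N.
  move=> m n _ _; exists (maxn m n) => // eta /cylinder_prefixP h.
  split; apply/cylinder_prefixP => i il; apply: h;
    by rewrite leq_max il ?orbT.
suff : F --> xi by move=> /(_ U)[|n _ nU]; [exact: open_nbhs_nbhs|exists n].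
apply/cvg_sup => i A [_ [[C _ <-] Cxi] CA].
exists i.+1 => // eta /cylinder_prefixP h.
by apply: CA; rewrite /= /proj h.
Qed.

End shift_space.

(** * Borel sets of the shift space *)

Section borel_shift_space.
Context (k : nat).
Implicit Types (xi eta : shift_space k) (w a : seq 'I_k.+1).
Local Notation X := (borel_shift_space k).

(** Cylinders are nested or disjoint, so adding the empty set makes them a
    pi-system. *)
Definition cylinders : set (set X) :=
  [set A | A = set0 \/ exists a, A = @cylinder k a].

Lemma cylinders_setI_closed : setI_closed cylinders.
Proof.
move=> _ _ [->|[a ->]] [->|[b ->]]; rewrite ?setI0 ?set0I; try by left.
suff wlg (c d : seq 'I_k.+1) : (size c <= size d)%N ->
    cylinders (@cylinder k c `&` cylinder d).
  by case: (leqP (size a) (size b)) => [|/ltnW] /wlg//; rewrite setIC.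
move=> cd; case: (pselect (exists xi, cylinder c xi /\ cylinder d xi)); last first.
  move=> h; left; rewrite -subset0 => xi [? ?]; apply: h; by exists xi.
move=> [xi [xc xd]]; right; exists d; apply: setIidr => eta.
rewrite /cylinder /= => etad; rewrite -[RHS]xc.
have /prefix_wordP h : prefix_word eta (size d) = prefix_word xi (size d).
  by rewrite etad xd.
by apply/prefix_wordP => i ic; apply: h; exact: leq_trans cd.
Qed.

(** There are only countably many words, so this makes the Borel sets the
    sigma-algebra generated by the cylinders. *)
Lemma bigcup_cylinder (U : set (shift_space k)) : open U ->
  U = \bigcup_(w in [set w | cylinder w `<=` U]) cylinder w.
Proof.
move=> oU; apply/seteqP; split=> [xi Uxi|xi [w + wxi]]; last exact.
have [n nU] := nbhs_cylinder oU Uxi.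
by exists (prefix_word xi n) => //; exact: cylinder_prefix.
Qed.

Lemma measurable_borelE : @measurable _ X = <<s cylinders >>.
Proof.
apply/seteqP; split; apply: smallest_sub; do ?exact: smallest_sigma_algebra.
- move=> U oU; rewrite (bigcup_cylinder oU) bigcup_mkcond.
  apply: (@countable_bigcupT_measurable _ (g_sigma_algebraType cylinders)) => // w.
  case: ifP => _; last exact: measurable0.
  by apply: sub_sigma_algebra; right; exists w.
- move=> _ [->|[a ->]]; apply: sub_sigma_algebra; first exact: open0.
  exact: open_cylinder.
Qed.

Lemma measurable_cylinder w : @measurable _ X (cylinder w).
Proof. by apply: sub_sigma_algebra; exact: open_cylinder. Qed.

Lemma measurable_iter_shift n :
  measurable_fun setT (iter n (@Defs.shift k) : X -> X).
Proof.
apply: (@measurability _ _ X X _ _ (@open (shift_space k))) => //.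
move=> _ [U oU <-]; rewrite setTI; apply: sub_sigma_algebra.
rewrite [X in _ X](_ : _ = \bigcup_(w in
  [set w | cylinder w `<=` iter n (@Defs.shift k) @^-1` U]) cylinder w).
  by apply: bigcup_open => w _; exact: open_cylinder.
apply/seteqP; split=> [xi /= Uxi|xi [w + wxi]]; last exact.
have [m mU] := nbhs_cylinder oU Uxi.
exists (prefix_word xi (n + m)); last exact: cylinder_prefix.
move=> eta /cylinder_prefixP h; apply: mU; apply/cylinder_prefixP => i im.
by rewrite !iter_shiftE h// ltn_add2l.
Qed.

Definition determined n (A : set X) := forall xi eta : X,
  prefix_word xi n = prefix_word eta n -> A xi -> A eta.

Lemma determinedE n (A : set X) : determined n A ->
  A = \bigcup_(w in [set w | cylinder w `<=` A]) cylinder w.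
Proof.
move=> nA; apply/seteqP; split=> [xi Axi|xi [w + wxi]]; last exact.
exists (prefix_word xi n); last exact: cylinder_prefix.
by move=> eta /cylinder_prefixP/prefix_wordP h; exact: nA Axi.
Qed.

Lemma measurable_determined n (A : set X) : determined n A -> measurable A.
Proof.
move=> /determinedE ->; apply: sub_sigma_algebra.
by apply: bigcup_open => w _; exact: open_cylinder.
Qed.

Lemma measure_sum_cylinder (R : realType) (mu : {measure set X -> \bar R}) n
    (A : set X) : measurable A ->
  mu A = (\sum_(w : n.-tuple 'I_k.+1) mu (A `&` cylinder w))%E.
Proof.
move=> mA; rewrite fsbig_seq ?index_enum_uniq//; set D := [set` _].
have {1}-> : A = \bigcup_(w in D) (A `&` cylinder w).
  apply/seteqP; split=> [xi Axi|xi [? _ []//]].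
  have sn : size (prefix_word xi n) == n by rewrite size_prefix_word.
  exists (Tuple sn); first by rewrite /D /= mem_index_enum.
  by split=> //; exact: cylinder_prefix.
rewrite measure_fin_bigcup//.
- exact: finite_seq.
- move=> v w _ _ [xi [[_ +] [_ +]]]; rewrite /cylinder /= !size_tuple => xv xw.
  by apply: val_inj; rewrite /= -xv -xw.
- by move=> w _; apply: measurableI => //; exact: measurable_cylinder.
Qed.

End borel_shift_space.

(** * The uniform Bernoulli measure from base-(k+1) digits *)

Section word_value.
Context (k : nat).
Implicit Types (w : seq 'I_k.+1).

(** The integer written [w] in base [k.+1], the head being the leading digit. *)
Definition word_value w : nat := foldl (fun v (i : 'I_k.+1) => v * k.+1 + i)%N 0%N w.

Lemma word_value_rcons w i : word_value (rcons w i) = (word_value w * k.+1 + i)%N.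
Proof. by rewrite /word_value -cats1 foldl_cat. Qed.

Lemma word_value_lt w : (word_value w < k.+1 ^ size w)%N.
Proof.
elim/last_ind: w => [|w i IH]; first by rewrite expn0.
rewrite word_value_rcons size_rcons expnSr.
apply: (@leq_trans (word_value w * k.+1 + k.+1)%N); first by rewrite ltn_add2l.
by rewrite addnC -mulSn leq_mul2r IH orbT.
Qed.

Lemma word_value_inj v w : size v = size w -> word_value v = word_value w -> v = w.
Proof.
elim/last_ind: v w => [|v i IH] w; first by case: w.
case/lastP: w => [|w j]; first by rewrite size_rcons.
rewrite !size_rcons !word_value_rcons => -[svw] e.
have eij : i = j.
  apply: val_inj; have := congr1 (modn^~ k.+1) e.
  by rewrite !modnMDl !modn_small.
congr rcons => //; apply: IH => //; move: e; rewrite eij => /addIn /eqP.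
by rewrite eqn_pmul2r// => /eqP.
Qed.

End word_value.

Section digits.
Context (R : realType) (k : nat).
Local Notation X := (borel_shift_space k).
Local Notation D := (`[0, 1[%classic : set (measurableTypeR R)).

(** The base-[k.+1] expansion of a point of [0, 1[; the points outside receive a
    constant value so that the function is total and measurable. *)
Definition digits (x : measurableTypeR R) : X :=
  if 0 <= x < 1 then fun n => inord (Num.trunc (k.+1%:R ^+ n.+1 * x) %% k.+1)
  else fun=> ord0.

(** Scaling by the base moves one more digit in front of the point, and the
    integer division erases it again. *)
Lemma truncn_divn (x : R) m : 0 <= x ->
  (Num.trunc (m.+1%:R * x) %/ m.+1)%N = Num.trunc x.
Proof.
move=> x0; apply/esym/eqP; rewrite truncn_eq//; apply/andP; split.
  have : (Num.trunc (m.+1%:R * x) %/ m.+1 * m.+1 <= Num.trunc (m.+1%:R * x))%N.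
    exact: leq_divM.
  by rewrite truncn_ge_nat ?mulr_ge0// natrM mulrC ler_pM2l// ltr0n.
rewrite -(ltr_pM2l (_ : 0 < m.+1%:R))// -natrM.
by rewrite -truncn_lt_nat ?mulr_ge0// mulnC ltn_ceil.
Qed.

(** The first [n] digits, read as an integer, are the integer part of [x] scaled
    by the [n]-th power of the base: this is what turns the digit condition
    defining a cylinder into membership in a single interval. *)
Lemma word_value_digits (x : R) n : 0 <= x < 1 ->
  word_value (prefix_word (digits x) n) = Num.trunc (k.+1%:R ^+ n * x).
Proof.
move=> x01; have /andP[x0 x1] := x01.
elim: n => [|n IH].
  by apply/esym/eqP; rewrite mul1r truncn_eq// x0.
rewrite /prefix_word mkseqS word_value_rcons IH /digits x01.
rewrite inordK ?ltn_mod//.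
by rewrite -(truncn_divn k (_ : 0 <= k.+1%:R ^+ n * x)) ?mulr_ge0// mulrA -exprS -divn_eq.
Qed.

Definition word_interval (w : seq 'I_k.+1) : set R :=
  `[(word_value w)%:R / k.+1%:R ^+ size w,
    (word_value w).+1%:R / k.+1%:R ^+ size w[%classic.

Lemma digits_cylinder w : D `&` digits @^-1` cylinder w = word_interval w.
Proof.
have K0 : 0 < k.+1%:R ^+ size w :> R by rewrite exprn_gt0.
have wE (x : R) : word_interval w x =
    ((word_value w)%:R <= k.+1%:R ^+ size w * x < (word_value w).+1%:R) :> Prop.
  by rewrite /word_interval /= in_itv /= ler_pdivrMr// ltr_pdivlMr// (mulrC x).
apply/seteqP; split=> x.
  rewrite wE /= in_itv /= => -[x01]; have /andP[x0 x1] := x01.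
  rewrite /cylinder /= => /(congr1 (@word_value k)); rewrite word_value_digits//.
  by move/eqP; rewrite truncn_eq// mulr_ge0// ltW.
rewrite wE => /andP[lx xl].
have x0 : 0 <= x by rewrite -(pmulr_rge0 _ K0) (le_trans _ lx).
have x1 : x < 1.
  rewrite -(ltr_pM2l K0) mulr1 (lt_le_trans xl)// -natrX ler_nat.
  exact: word_value_lt.
split; first by rewrite /= in_itv /= x0.
apply: word_value_inj; first by rewrite size_prefix_word.
by rewrite word_value_digits ?x0//; apply/eqP; rewrite truncn_eq ?lx// mulr_ge0// ltW.
Qed.

Lemma measurable_digits : measurable_fun setT digits.
Proof.
rewrite -(setUv D); apply/measurable_funU => //; first exact: measurableC.
split.
  apply: (@measurability _ _ _ X _ _ (@cylinders k)); first exact: measurable_borelE.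
  move=> _ [_ [->|[w ->]] <-]; first by rewrite preimage_set0 setI0.
  by rewrite digits_cylinder; exact: measurable_itv.
apply: (@eq_measurable_fun _ _ _ _ _ (fun=> (fun=> ord0) : X)) => // x.
by rewrite inE /digits /= in_itv /=; case: ifP.
Qed.

HB.instance Definition _ := isMeasurableFun.Build _ _ _ _ digits measurable_digits.

Lemma measurable_unit : measurable D. Proof. by []. Qed.

Definition unit_lebesgue := mrestr (@lebesgue_measure R) measurable_unit.

HB.instance Definition _ := Measure.on unit_lebesgue.

Lemma unit_lebesgue_setT : unit_lebesgue setT = 1%E.
Proof.
by rewrite /unit_lebesgue /mrestr setTI lebesgue_measure_itv /= lte_fin ltr01 oppr0 adde0.
Qed.

HB.instance Definition _ :=
  Measure_isProbability.Build _ _ _ unit_lebesgue unit_lebesgue_setT.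

Definition bernoulli_shift : probability X R := distribution unit_lebesgue digits.

Lemma bernoulli_shift_cylinder w :
  bernoulli_shift (cylinder w) = (k.+1%:R ^- size w)%:E.
Proof.
rewrite /bernoulli_shift /= /distribution /pushforward /= /unit_lebesgue /mrestr.
rewrite setIC digits_cylinder lebesgue_measure_itv /= lte_fin.
rewrite ltr_pM2r ?invr_gt0 ?exprn_gt0// ltr_nat ltnSn.
by rewrite -EFinB -mulrBl -addn1 natrD addrAC subrr add0r mul1r.
Qed.

End digits.

(** * Mixing of the uniform Bernoulli measure *)

Section bernoulli.
Context (R : realType) (k : nat).
Local Notation X := (borel_shift_space k).
Local Notation mu := (bernoulli_shift R k).
Local Notation sh n := (iter n (@Defs.shift k)).
Local Open Scope ereal_scope.

(** For fixed [w] both sides are finite measures in [A], and they agree on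
    cylinders, because the letters of [w] followed by those of [A] spell a longer
    cylinder. *)
Lemma bernoulli_shift_indep (w : seq 'I_k.+1) (A : set X) : measurable A ->
  mu (sh (size w) @^-1` A `&` cylinder w) = mu A * mu (cylinder w).
Proof.
have c0 : (0 <= k.+1%:R ^- size w :> R)%R by rewrite invr_ge0 exprn_ge0.
have mw : measurable (cylinder w : set X) := measurable_cylinder w.
have msh := @measurable_iter_shift k (size w).
suff E : forall A : set X, measurable A ->
    pushforward (mrestr mu mw) (sh (size w) : X -> X) A = mscale (NngNum c0) mu A.
  move=> mA; rewrite bernoulli_shift_cylinder muleC.
  by rewrite -[RHS]/(mscale (NngNum c0) mu A) -E.
apply: (@measure_unique _ R X (@cylinders k) (fun=> setT)).
- exact: measurable_borelE.
- exact: cylinders_setI_closed.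
- move=> _; right; exists [::]; apply/seteqP; split=> //.
- by rewrite bigcup_const.
- move=> _ [->|[a ->]]; first by rewrite !measure0.
  rewrite -[LHS]/(mu (sh (size w) @^-1` cylinder a `&` cylinder w)).
  rewrite -[RHS]/((k.+1%:R ^- size w)%:E * mu (cylinder a)).
  by rewrite setIC -cylinder_cat !bernoulli_shift_cylinder size_cat exprD invfM.
- move=> _; rewrite -[ltLHS]/(mu (sh (size w) @^-1` setT `&` cylinder w)).
  by rewrite preimage_setT setTI bernoulli_shift_cylinder ltry.
Qed.

(** Such a [B] is a finite disjoint union of cylinders of length [n]. *)
Lemma bernoulli_shift_indep_determined n (A B : set X) : measurable A ->
  determined n B -> mu (sh n @^-1` A `&` B) = mu A * mu B.
Proof.
move=> mA nB; have mB := measurable_determined nB.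
have mS : measurable (sh n @^-1` A : set X).
  by rewrite -[X in measurable X]setTI; exact: measurable_iter_shift.
rewrite (measure_sum_cylinder mu n (measurableI _ _ mS mB)).
rewrite (measure_sum_cylinder mu n mB) ge0_sume_distrr//.
apply: eq_bigr => w _; rewrite -setIA.
have [->|/set0P[xi [Bxi xiw]]] := eqVneq (B `&` cylinder w) set0.
  by rewrite setI0 !measure0 mule0.
have -> : B `&` cylinder w = cylinder w.
  apply: setIidr => eta etaw; apply: nB Bxi.
  by move: etaw xiw; rewrite /cylinder /= size_tuple => -> ->.
by have := bernoulli_shift_indep w mA; rewrite size_tuple.
Qed.

Lemma bernoulli_shift_invariant n (A : set X) : measurable A ->
  mu (sh n @^-1` A) = mu A.
Proof.
move=> mA; have := @bernoulli_shift_indep_determined n A setT mA.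
by rewrite setIT probability_setT mule1; exact.
Qed.

(** For a cylinder [B] the sequence of measures is eventually constant. The sets
    [B] with the right limit are stable under complement by invariance of the
    measure, and under countable disjoint union because the tail of the union
    contributes little, uniformly in [n]. *)
Lemma mixing_bernoulli_shift : mixing mu.
Proof.
move=> A B mA mB.
pose m C := fine (mu C); pose S n : set X := sh n @^-1` A.
pose P (C : set X) := (m (S n `&` C) @[n --> \oo] --> m A * m C)%R.
have mS n : measurable (S n).
  by rewrite -[X in measurable X]setTI; exact: measurable_iter_shift.
have fin C : measurable C -> mu C \is a fin_num by move=> ?; exact: fin_num_measure.
suff PB : P B.
  have -> : mu A * mu B = (m A * m B)%:E by rewrite EFinM !fineK// fin.
  apply/fine_cvgP; split=> //; apply: nearW => n.
  by apply: fin; apply: measurableI => //; exact: mS.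
have mU C D : measurable C -> measurable D -> C `&` D = set0 ->
    m (C `|` D) = (m C + m D)%R.
  by move=> mC mD CD; rewrite /m measureU// fineD// fin.
have PU C D : measurable C -> measurable D -> C `&` D = set0 ->
    P C -> P D -> P (C `|` D).
  move=> mC mD CD PC PD; rewrite /P mU// mulrDr.
  rewrite (_ : (fun n => _) = (fun n => m (S n `&` C) + m (S n `&` D))%R).
    exact: cvgD.
  apply/funext => n; rewrite setIUr mU//; try exact: measurableI.
  by rewrite setIACA CD setI0.
have m0 : m set0 = 0%R by rewrite /m measure0.
have P0 : P set0.
  by apply: cvg_near_cst; apply: nearW => n; rewrite setI0 m0 mulr0.
have PT : P setT.
  rewrite /P (_ : m setT = 1)%R ?mulr1; last by rewrite /m probability_setT.
  by apply: cvg_near_cst; apply: nearW => n; rewrite setIT /m bernoulli_shift_invariant.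
have : <<s @cylinders k >> B by rewrite -measurable_borelE.
apply: (@dynkin_induction _ X _ P) => //.
- exact: measurable_borelE.
- exact: cylinders_setI_closed.
- move=> _ [->//|[w ->]].
  apply: cvg_near_cst; exists (size w) => // n /= wn.
  have nw : determined n (cylinder w : set X).
    move=> xi eta /prefix_wordP h; rewrite /cylinder /= => xiw; rewrite -[RHS]xiw.
    by apply/prefix_wordP => i iw; rewrite h// (leq_trans iw).
  rewrite /m bernoulli_shift_indep_determined// fineM ?fin//.
  exact: measurable_cylinder.
- move=> C mC PC.
  have mC' : measurable (~` C) by exact: measurableC.
  have mCE D : measurable D -> m (D `&` ~` C) = (m D - m (D `&` C))%R.
    move=> mD; rewrite -[X in (m X - _)%R]setIT -(setUv C) setIUr mU.
    - by rewrite addrAC subrr add0r.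
    - exact: measurableI.
    - exact: measurableI.
    - by rewrite setIACA setICr setI0.
  rewrite /P -[X in (_ * m X)%R]setTI mCE// mulrBr setTI.
  rewrite (_ : (fun n => _) = (fun n => m (S n `&` setT) - m (S n `&` C))%R).
    exact: cvgB.
  by apply/funext => n; rewrite mCE// setIT.
- move=> F mF tF PF.
  set U := \bigcup_k F k; have mUU : measurable U by exact: bigcupT_measurable.
  pose V N := \bigcup_(i in `I_N) F i.
  have mV N : measurable (V N) by exact: bigcup_measurable.
  have PV N : P (V N).
    elim: N => [|N IH]; first by rewrite /V II0 bigcup_set0.
    have -> : V N.+1 = V N `|` F N by rewrite /V !bigcup_mkord big_ord_recr.
    apply: PU => //; rewrite -subset0 => x [[i /= iN Fix] FNx].
    have iN' := tF i N I I (ex_intro _ x (conj Fix FNx)).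
    by rewrite iN' ltnn in iN.
  have cV : (m (V N) @[N --> \oo] --> m U)%R.
    apply: fine_cvg; rewrite fineK ?fin//.
    have -> : U = \bigcup_N V N.
      apply/seteqP; split => [x [i _ Fix]|x [N _ [i _ Fix]]]; last by exists i.
      by exists i.+1 => //; exists i => /=.
    apply: nondecreasing_cvg_mu => //; first exact: bigcup_measurable.
    move=> M N MN; apply/subsetPset => x [i /= iM Fix]; exists i => //=.
    exact: leq_trans MN.
  have m_ge0 C : (0 <= m C)%R by rewrite /m fine_ge0.
  have mA1 : (m A <= 1)%R.
    by rewrite -lee_fin fineK ?fin// probability_le1.
  apply/cvgrPdist_lt => e e0; have e20 : (0 < e / 2)%R by rewrite divr_gt0.
  have /cvgrPdist_lt/(_ _ e20)[N _ /(_ N (leqnn N)) mVN] := cV.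
  have UE : U = V N `|` (U `\` V N).
    rewrite setDUK// => x [i _ Fix]; by exists i.
  (* The two terms to be compared on the tail D both lie between 0 and m D. *)
  set D := U `\` V N in UE; have mD : measurable D by exact: measurableD.
  have VD : V N `&` D = set0 by rewrite /D setDIK.
  have mUE : m U = (m (V N) + m D)%R by rewrite {1}UE mU.
  have mDe : (m D < e / 2)%R.
    by move: mVN; rewrite mUE addrAC subrr add0r ger0_norm.
  have /cvgrPdist_lt/(_ _ e20) := PV N.
  apply: filterS => n nV; rewrite mUE {1}UE setIUr mU; last first.
  - by rewrite setIACA VD setI0.
  - exact: measurableI.
  - exact: measurableI.
  rewrite mulrDr opprD addrACA (splitr e) (le_lt_trans (ler_normD _ _))//.
  rewrite ltrD// (le_lt_trans _ mDe)//.
  have mSD : (m (S n `&` D) <= m D)%R.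
    rewrite fine_le ?fin//; first exact: measurableI.
    by apply: le_measure; rewrite ?inE//; exact: measurableI.
  rewrite ler_norml; apply/andP; split.
    by rewrite lerBrDl (le_trans _ (mulr_ge0 _ _))// subr_le0.
  by rewrite lerBlDr (le_trans (ler_piMl _ mA1))// lerDl.
Qed.

End bernoulli.

(** * Markov measures of full support *)

Section bernoulli_markov.
Context (R : realType) (k : nat).

Lemma markov_bernoulli_shift : markov_measure (bernoulli_shift R k).
Proof.
have K0 : k.+1%:R != 0 :> R by rewrite pnatr_eq0.
have sumK : \sum_(j < k.+1) k.+1%:R^-1 = 1 :> R.
  by rewrite sumr_const card_ord -[LHS]mulr_natl divff.
exists (const_mx k.+1%:R^-1), (const_mx k.+1%:R^-1); split.
- split=> [i j|i]; first by rewrite mxE.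
  by under eq_bigr do rewrite mxE.
- by move=> l r; exists 1%N => //; rewrite expr1 mxE invr_gt0.
- split=> [i||]; first by rewrite mxE.
    by under eq_bigr do rewrite mxE.
  apply/matrixP => i j; rewrite !mxE.
  by under eq_bigr do rewrite !mxE; rewrite -mulr_suml sumK mul1r.
- move=> a s; rewrite bernoulli_shift_cylinder /= exprS invfM mxE; congr (_ * _)%:E.
  under eq_bigr do rewrite mxE.
  rewrite big_const_seq count_predT size_zip /= (minn_idPr _)// -exprVn.
  by rewrite iter_mulr_1.
Qed.

Lemma measure_support_bernoulli_shift :
  measure_support (bernoulli_shift R k) = setT.
Proof.
apply/seteqP; split=> // xi _ U oU Uxi.
have [n nU] := nbhs_cylinder oU Uxi.
apply: (@lt_le_trans _ _ (bernoulli_shift R k (cylinder (prefix_word xi n)))).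
  by rewrite bernoulli_shift_cylinder lte_fin invr_gt0 exprn_gt0.
apply: le_measure => //; rewrite inE; first exact: measurable_cylinder.
exact: sub_sigma_algebra.
Qed.

End bernoulli_markov.

Section positive_markov.
Context (R : realType) (k : nat).
Context (mu : probability (borel_shift_space k) R).
Hypothesis markov_mu : markov_measure mu.
Hypothesis full_mu : measure_support mu = setT.

(** Full support gives positive measure to the cylinders of length two, hence
    makes all the transition probabilities positive; [r] is their minimum. *)
Lemma markov_full_support_lower_bound : exists2 r : R, 0 < r <= 1 &
  forall (v w : seq 'I_k.+1), v != [::] ->
    ((r ^+ size w)%:E * mu (cylinder v) <= mu (cylinder (v ++ w)))%E.
Proof.
have [P [p [[P0 P1] _ [p0 _ _] muE]]] := markov_mu.
have Ppos i j : 0 < P i j.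
  have : (0 < mu (cylinder [:: i; j]))%E.
    have : measure_support mu (fun n => if n is 0%N then i else j) by rewrite full_mu.
    by apply; first exact: open_cylinder.
  rewrite muE /= big_seq1 /= lte_fin => h.
  rewrite lt_neqAle P0 andbT; apply: contraTneq h => <-; by rewrite mulr0 ltxx.
have Ple1 i j : P i j <= 1.
  by rewrite -(P1 i) (bigD1 j)//= lerDl sumr_ge0.
pose r := \big[Num.min/1]_(ij : 'I_k.+1 * 'I_k.+1) P ij.1 ij.2.
have rP i j : r <= P i j by exact: (bigmin_le _ (i, j)).
have r0 : 0 < r by apply/lt_bigmin.
have r1 : r <= 1 by exact: bigmin_le_id.
exists r; first by rewrite r0.
move=> v w v0; elim/last_ind: w => [|w j IH]; first by rewrite cats0 expr0 mul1e.
have step (u : seq 'I_k.+1) i : u != [::] ->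
    (r%:E * mu (cylinder u) <= mu (cylinder (rcons u i)))%E.
  case: u => // a s _; rewrite rcons_cons !muE -EFinM lee_fin.
  have -> : zip (a :: rcons s i) (rcons s i) = rcons (zip (a :: s) s) (last a s, i).
    elim: s a => //= b s IHs a; congr (_ :: _); exact: IHs.
  rewrite big_rcons /= mulrA mulrC ler_wpM2l// mulr_ge0// prodr_ge0//.
rewrite -rcons_cat size_rcons exprS EFinM -muleA.
apply: (le_trans _ (step _ _ _)); last by case: (v) v0.
by rewrite lee_pmul2l.
Qed.

End positive_markov.

(** * Images of words and weak hyperbolicity *)

Section word_images.
Context (R : realType) (k : nat) (T : 'I_k.+1 -> R -> R).
Local Notation J01 := (unit_interval R).
Hypothesis T_cont : forall i, {within J01, continuous (T i)}.
Hypothesis T_unit : forall i, T i @` J01 `<=` J01.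
Implicit Types (xi : shift_space k) (s : seq 'I_k.+1).

Definition word_image s : set R := word_map T s @` J01.

Lemma word_image_sub s : word_image s `<=` J01.
Proof. by move=> _ [x Ix <-]; exact: word_map_unit. Qed.

Lemma word_image_catl s t : word_image (s ++ t) `<=` word_image s.
Proof.
move=> _ [x Ix <-]; exists (word_map T t x); first exact: word_map_unit.
by rewrite word_map_cat.
Qed.

Lemma word_image_prefix xi m n : (m <= n)%N ->
  word_image (prefix_word xi n) `<=` word_image (prefix_word xi m).
Proof. by move=> /(prefix_word_split xi)[s ->]; exact: word_image_catl. Qed.

(** The maps are continuous on the unit interval only, so connectedness is
    carried along the word one letter at a time. *)
Lemma word_image_interval s : is_interval (word_image s).
Proof.
elim: s => [|i s IH].
  rewrite /word_image image_id; exact: interval_is_interval.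
apply/connected_intervalP.
have -> : word_image (i :: s) = T i @` word_image s by rewrite /word_image -image_comp.
apply: connected_continuous_connected; first exact/connected_intervalP.
apply: (continuous_subspaceW _ (@T_cont i)); exact: word_image_sub.
Qed.


Lemma word_image_nonempty s : word_image s (word_map T s 0).
Proof. by exists 0 => //; rewrite /unit_interval /= in_itv /= lexx ler01. Qed.

Lemma word_image_lbound s : has_lbound (word_image s).
Proof. by exists 0 => x /word_image_sub; rewrite /unit_interval /= in_itv /= => /andP[]. Qed.

Lemma diam_word_image_le s (e : R) :
  (forall x y, word_image s x -> word_image s y -> `|x - y| <= e) ->
  diam (word_image s) <= e.
Proof.
move=> h; apply: ge_sup.
  exists `|word_map T s 0 - word_map T s 0|.
  by exists (word_map T s 0); [|exists (word_map T s 0) => //]; exact: word_image_nonempty.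
by move=> _ [x wx [y wy <-]]; exact: h.
Qed.

(** Nested intervals whose diameters stay above some [e] share an open interval
    of length [e], hence two rationals. Describing the failure of weak
    hyperbolicity through rationals makes it a countable union of measurable
    events. *)
Lemma weakly_hyperbolicE : weakly_hyperbolic T =
  ~` \bigcup_(qr in [set qr : rat * rat | qr.1 < qr.2])
     \bigcap_n [set xi | word_image (prefix_word xi n.+1) (ratr qr.1) /\
                       word_image (prefix_word xi n.+1) (ratr qr.2)].
Proof.
apply/seteqP; split=> xi.
  move=> /cvgrPdist_lt hxi [[q r] /= qr h].
  have d0 : 0 < ratr r - ratr q :> R by rewrite subr_gt0 ltr_rat.
  have [N _ /(_ N (leqnn N))] := hxi _ d0.
  rewrite sub0r normrN => /(le_lt_trans (ler_norm _)).
  have [hq hr] := h N I; rewrite ltNge => /negP; apply.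
  rewrite -[leLHS]gtr0_norm//; apply: dist_le_diam => //; exact: word_image_sub.
apply: contra_notP => nhxi.
pose A n := word_image (prefix_word xi n.+1).
have [e e0 wide] : exists2 e, 0 < e &
    forall n, exists x y, [/\ A n x, A n y & x + e < y].
  apply: contrapT => h; apply: nhxi; apply/cvgrPdist_le => e e0.
  have [N hN] : exists N, ~ exists x y, [/\ A N x, A N y & x + e < y].
    by apply/not_existsP => w; apply: h; exists e => // n; exact: contrapT.
  exists N => // n /= Nn; rewrite sub0r normrN ger0_norm; last first.
    have An := @word_image_nonempty (prefix_word xi n.+1).
    have := dist_le_diam (@word_image_sub _) An An.
    by rewrite subrr normr0.
  apply: diam_word_image_le => x y /(word_image_prefix (Nn : N.+1 <= n.+1)%N) Ax
    /(word_image_prefix (Nn : N.+1 <= n.+1)%N) Ay.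
  rewrite leNgt; apply: contra_notN hN; rewrite ltr_normr.
  by case/orP => xy; [exists y, x|exists x, y]; split=> //; lra.
(* The common open interval is ]c, c + e[. *)
pose c := sup (range (fun n => inf (A n))).
have cA n : inf (A n) <= c.
  apply: ub_le_sup; last by exists n.
  exists 1 => _ [m _ <-]; have [x [_ [Ax _ _]]] := wide m.
  apply: (le_trans (ge_inf (word_image_lbound _) Ax)).
  by have /word_image_sub := Ax; rewrite /unit_interval /= in_itv /= => /andP[].
have Ac n y : c < y -> y < c + e -> A n y.
  move=> cy ye.
  have A0 : A n !=set0 by have [x [_ [Ax _ _]]] := wide n; exists x.
  have [x Ax xy] := inf_lt A0 (le_lt_trans (cA n) cy).
  have [z Az yz] : exists2 z, A n z & y <= z.
    apply: contrapT => h; move: ye; apply/negP; rewrite -leNgt -lerBrDr.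
    apply: ge_sup; first by exists (inf (A 0%N)); exists 0%N.
    move=> _ [m _ <-]; have [u [v [Au Av uv]]] := wide (maxn m n).
    have Amu : A m u by apply: word_image_prefix Au; rewrite ltnS leq_maxl.
    have Anv : A n v by apply: word_image_prefix Av; rewrite ltnS leq_maxr.
    apply: (le_trans (ge_inf (word_image_lbound _) Amu)).
    have /negP : ~ y <= v by move=> yv; apply: h; exists v.
    rewrite -ltNge; lra.
  apply: (@word_image_interval (prefix_word xi n.+1) x z) => //.
  by rewrite (ltW xy).
have ce : c < c + e by rewrite ltrDl.
have [q] := rat_in_itvoo ce.
rewrite in_itv /= => /andP[cq qe].
have [r] := rat_in_itvoo qe; rewrite in_itv /= => /andP[qr re].
exists (q, r); first by rewrite /= -(ltr_rat R).
by move=> n _; split; apply: Ac => //=; exact: lt_trans qr.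
Qed.

(** * Two words with disjoint images force almost sure weak hyperbolicity *)

Section splitting.
Context (mu : probability (borel_shift_space k) R).
Hypothesis markov_mu : markov_measure mu.
Hypothesis full_mu : measure_support mu = setT.
Context (a b : R).
Hypothesis T_J : forall i, T i @` `[a, b] `<=` `[a, b].
Hypothesis T_inj : forall i, set_inj `[a, b] (T i).
Variables (u v : seq 'I_k.+1).
Hypothesis uv_disj : word_image u `&` word_image v = set0.
Hypothesis uv_J : word_image u `|` word_image v `<=` `[a, b].

Lemma word_map_J s (x : R) : `[a, b]%classic x -> `[a, b]%classic (word_map T s x).
Proof. by move=> xJ; elim: s => //= i s IH; apply: (@T_J i); exists (word_map T s x). Qed.

Lemma word_map_inj s : set_inj `[a, b] (word_map T s).
Proof.
elim: s => [|i s IH] x y //; rewrite !inE => xJ yJ /= e.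
apply: IH; rewrite ?inE//; apply: (@T_inj i) => //; rewrite inE; exact: word_map_J.
Qed.

(** The word [w] is injective on J, where the images of [u ++ v] and [v ++ u] are
    disjoint. Using these two concatenations instead of [u] and [v] makes both
    continuations equally long. *)
Lemma word_image_splitting w (q : R) :
  exists2 t, size t = (size u + size v)%N & ~ word_image (w ++ t) q.
Proof.
apply: contrapT => h.
have {}h t : size t = (size u + size v)%N -> word_image (w ++ t) q.
  by move=> st; apply: contrapT => nq; apply: h; exists t.
have [x ux xq] : exists2 x, word_image u x & word_map T w x = q.
  have [|z Iz] := h (u ++ v); first by rewrite size_cat.
  rewrite !word_map_cat => zq; exists (word_map T u (word_map T v z)) => //.
  by exists (word_map T v z) => //; exact: word_map_unit.
have [y vy yq] : exists2 y, word_image v y & word_map T w y = q.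
  have [|z Iz] := h (v ++ u); first by rewrite size_cat addnC.
  rewrite !word_map_cat => zq; exists (word_map T v (word_map T u z)) => //.
  by exists (word_map T u z) => //; exact: word_map_unit.
have xy : x = y.
  by apply: (@word_map_inj w); rewrite ?inE ?xq//; apply: uv_J; [left|right].
have : (word_image u `&` word_image v) x by split=> //; rewrite xy.
by rewrite uv_disj.
Qed.

Definition hitting (q : R) n : set (borel_shift_space k) :=
  [set xi | word_image (prefix_word xi n) q].

Lemma measurable_hitting q n : measurable (hitting q n).
Proof.
by apply: (@measurable_determined _ n) => xi eta; rewrite /hitting /= => ->.
Qed.

(** Inside each cylinder of length [n.+1] that meets the event, the continuation
    missing [q] occupies at least a fraction [d]. The length is positive because
    the lower bound for the transitions needs a previous letter. *)
Lemma measure_hitting_contract : exists2 d : R, 0 < d <= 1 & forall q n,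
  (mu (hitting q (n.+1 + (size u + size v))) <= (1 - d)%:E * mu (hitting q n.+1))%E.
Proof.
have [r /andP[r0 r1] hr] := markov_full_support_lower_bound markov_mu full_mu.
set l := (size u + size v)%N.
exists (r ^+ l); first by rewrite exprn_gt0// exprn_ile1// ltW.
move=> q n; set E' := hitting _ _; set E := hitting q _.
have mE := measurable_hitting q n.+1 : measurable E.
have mE' := measurable_hitting q (n.+1 + l) : measurable E'.
rewrite (measure_sum_cylinder mu n.+1 mE) (measure_sum_cylinder mu n.+1 mE').
rewrite ge0_sume_distrr//; apply: lee_sum => w _.
have mC (s : seq 'I_k.+1) : measurable (cylinder s : set (borel_shift_space k)).
  exact: measurable_cylinder.
have d1 : 0 <= 1 - r ^+ l by rewrite subr_ge0 exprn_ile1// ltW.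
have [->|/set0P[xi [E'xi xiw]]] := eqVneq (E' `&` cylinder w) set0.
  by rewrite measure0 mule_ge0// lee_fin.
have wq : word_image w q.
  have := word_image_prefix (leq_addr l n.+1) E'xi.
  by move: xiw; rewrite /cylinder /= size_tuple => ->.
have -> : E `&` cylinder w = cylinder w.
  by apply: setIidr => eta; rewrite /cylinder /= size_tuple /E /hitting /= => ->.
have [t st tq] := word_image_splitting w q.
have := hr w t; rewrite st -/l => /(_ _)/wrap[]; first by rewrite -size_eq0 size_tuple.
move=> lb.
have le : (mu (E' `&` cylinder w) + mu (cylinder (w ++ t)) <= mu (cylinder w))%E.
  rewrite -measureU//; last 2 first.
  - exact: measurableI.
  - rewrite -subset0 => eta [[E'eta _]]; rewrite /cylinder /= size_cat size_tuple st => e.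
    by apply: tq; move: E'eta; rewrite /E' /hitting /= e.
  apply: le_measure; rewrite ?inE//; first by apply: measurableU => //; exact: measurableI.
  by rewrite cylinder_cat => eta [[]//|[]].
have fin C : measurable C -> mu C \is a fin_num by move=> ?; exact: fin_num_measure.
have mI : measurable (E' `&` cylinder w) by exact: measurableI.
move: lb le; rewrite -(fineK (fin _ (mC w))) -(fineK (fin _ (mC (w ++ t)))).
rewrite -(fineK (fin _ mI)).
rewrite -!EFinM -EFinD !lee_fin => lb le.
have key : fine (mu (E' `&` cylinder w)) <= (1 - r ^+ l) * fine (mu (cylinder w)).
  lra.
by rewrite -[leLHS]fineK ?fin// -[X in (_ * X)%E]fineK ?fin.
Qed.

Lemma measure_hitting_cap q : mu (\bigcap_n hitting q n.+1) = 0%E.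
Proof.
have [d /andP[d0 d1] hd] := measure_hitting_contract.
set l := (size u + size v)%N in hd.
have mcap : measurable (\bigcap_n hitting q n.+1).
  by apply: bigcapT_measurable => n; exact: measurable_hitting.
have geom m : (mu (hitting q (m * l).+1) <= ((1 - d) ^+ m)%:E)%E.
  elim: m => [|m IH].
    by rewrite expr0; apply: probability_le1; exact: measurable_hitting.
  rewrite mulSn addnC -addSn (le_trans (hd _ _))// exprS EFinM.
  by rewrite lee_wpmul2l// lee_fin subr_ge0.
have bound m : fine (mu (\bigcap_n hitting q n.+1)) <= (1 - d) ^+ m.
  rewrite -lee_fin fineK ?fin_num_measure//; apply: le_trans (geom m).
  apply: le_measure; rewrite ?inE//; first exact: measurable_hitting.
  by move=> xi; apply.
rewrite -(fineK (fin_num_measure mu _ mcap)); congr EFin; apply/eqP.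
rewrite eq_le fine_ge0// andbT.
have cvg0 : (1 - d) ^+ m @[m --> \oo] --> 0.
  by apply: cvg_expr; rewrite ger0_norm ?subr_ge0//; lra.
rewrite -(cvg_lim _ cvg0)//; apply: limr_ge; first by apply/cvg_ex; exists 0.
exact: nearW.
Qed.

Lemma weakly_hyperbolic_full : mu (weakly_hyperbolic T) = 1%E.
Proof.
rewrite weakly_hyperbolicE; set B := \bigcup_(_ in _) _.
pose C (q : rat) : set (borel_shift_space k) := \bigcap_n hitting (ratr q) n.+1.
have mC q : measurable (C q).
  by apply: bigcapT_measurable => n; exact: measurable_hitting.
have BE : B = \bigcup_(qr in [set qr : rat * rat | qr.1 < qr.2]) (C qr.1 `&` C qr.2).
  apply: eq_bigcupr => -[q r] _ /=.
  apply/seteqP; split=> [xi h|xi [hq hr] n _]; last by split; [exact: hq|exact: hr].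
  by split=> n _; have [] := h n I.
have mB : measurable (B : set (borel_shift_space k)).
  rewrite BE bigcup_mkcond.
  apply: countable_bigcupT_measurable => // qr.
  by case: ifP => // _; exact: measurableI.
rewrite probability_setC// (_ : mu B = 0%E) ?sube0//.
(* The rationals are enumerated through unpickle to use sigma-subadditivity. *)
pose F n : set (borel_shift_space k) := if unpickle n is Some q then C q else set0.
have F0 n : mu.-negligible (F n).
  rewrite /F; case: unpickle => [q|]; last exact: negligible_set0.
  by apply/negligibleP => //; exact: measure_hitting_cap.
apply/negligibleP => //; apply: negligibleS (negligible_bigcup F0).
rewrite BE => xi [[q r] _ [Cq _]]; exists (pickle q); first exact: I.
by rewrite /F pickleK.
Qed.

End splitting.
End word_images.

(** * Target points *)

Section target.
Context (R : realType) (k : nat) (T : 'I_k.+1 -> R -> R).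
Local Notation J01 := (unit_interval R).
Hypothesis T_cont : forall i, {within J01, continuous (T i)}.
Hypothesis T_unit : forall i, T i @` J01 `<=` J01.
Implicit Types (xi : shift_space k) (s : seq 'I_k.+1).

(** Weak hyperbolicity together with the value of the code, in one condition on
    the images of the prefixes: prepending a letter to the sequence and picking
    a prefix with small image then become immediate. *)
Definition shrinks_to xi (x : R) := forall e, 0 < e -> exists N, forall n,
  (N <= n)%N -> forall y, word_image T (prefix_word xi n) y -> `|x - y| <= e.

Lemma weakly_hyperbolic_shrinks xi :
  weakly_hyperbolic T xi -> shrinks_to xi (coding T xi).
Proof.
move=> hxi e e0; have e20 : 0 < e / 2 by rewrite divr_gt0.
have Z01 : J01 0 by rewrite /unit_interval /= in_itv /= lexx ler01.
have /cvgrPdist_lt/(_ _ e20)[N1 _ h1] := coding_cvg T_unit hxi Z01.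
have /cvgrPdist_lt/(_ _ e20)[N2 _ h2] := hxi.
exists (maxn N1 N2).+1 => -[//|n]; rewrite ltnS geq_max => /andP[n1 n2] y wy.
have := h1 n n1; have := h2 n n2 => /=; rewrite sub0r normrN => /(le_lt_trans (ler_norm _)).
have := dist_le_diam (word_image_sub T_unit (s := _)) (word_image_nonempty _ _) wy.
move=> /le_lt_trans /[apply] h h'.
rewrite -(subrK (word_map T (prefix_word xi n.+1) 0) (coding T xi)) -addrA.
by rewrite (le_trans (ler_normD _ _))// ltW// (splitr e) ltrD.
Qed.

Lemma shrinks_weakly_hyperbolic xi x :
  shrinks_to xi x -> weakly_hyperbolic T xi /\ coding T xi = x.
Proof.
move=> h; split.
  apply/cvgrPdist_le => e e0; have e20 : 0 < e / 2 by rewrite divr_gt0.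
  have [N hN] := h _ e20; exists N => // n /= Nn.
  have A0 := word_image_nonempty T (prefix_word xi n.+1).
  rewrite sub0r normrN ger0_norm; last first.
    have := dist_le_diam (word_image_sub T_unit (s := _)) A0 A0.
    by rewrite subrr normr0.
  apply: diam_word_image_le => u v Au Av.
  have Nn1 : (N <= n.+1)%N by rewrite ltnW.
  have := hN _ Nn1 _ Au; have := hN _ Nn1 _ Av.
  rewrite !ler_norml => /andP[? ?] /andP[? ?]; lra.
apply: cvg_lim => //; apply/cvgrPdist_le => e e0.
have [N hN] := h _ e0; exists N => // n /= Nn.
apply: (hN n.+1); first by rewrite ltnW.
exact: word_image_nonempty.
Qed.

Lemma targetP x : target T x <-> exists xi, shrinks_to xi x.
Proof.
split=> [[xi hxi <-]|[xi /shrinks_weakly_hyperbolic[? ?]]]; last by exists xi.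
by exists xi; exact: weakly_hyperbolic_shrinks.
Qed.

(** The code of a sequence is the limit of the images of any base point, in
    particular of the left endpoint of an invariant interval. *)
Lemma target_itv (c d x : R) : `[c, d] `<=` J01 -> c <= d ->
  (forall i, T i @` `[c, d] `<=` `[c, d]) -> target T x -> c <= x <= d.
Proof.
move=> cdI cd Tcd [xi hxi <-].
have cI : J01 c by apply: cdI; rewrite /= in_itv /= lexx.
have inv n : word_map T (prefix_word xi n.+1) c \in `[c, d].
  elim: (prefix_word _ _) => [|i s IH] /=; first by rewrite in_itv /= lexx.
  by apply: (@Tcd i); exists (word_map T s c).
have cv := coding_cvg T_unit hxi cI.
rewrite -[_ <= _ <= _]/(coding T xi \in `[c, d]).
have cl : closed `[c, d]%classic by exact: interval_closed.
apply: (@closed_cvg _ _ _ _ _ (fun y : R => y \in `[c, d]) cl _ _ cv).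
exact: nearW.
Qed.

Lemma target_unit x : target T x -> J01 x.
Proof. by move=> tx; rewrite /unit_interval /= in_itv /=; exact: target_itv tx. Qed.

(** Putting the letter [i] in front of a sequence coding [x] gives a sequence
    coding [T i x]. *)
Lemma target_invariant i x : target T x -> target T (T i x).
Proof.
move=> tx; have Ix := target_unit tx; move/targetP: tx => [xi hxi].
apply/targetP; exists (fun n => if n is m.+1 then xi m else i) => e e0.
have /subspace_continuousP/(_ x Ix) := @T_cont i.
move=> /cvgrPdist_le/(_ _ e0); rewrite /prop_near1 /within /= => /nbhs_ballP[d /= d0 hd].
have d20 : 0 < d / 2 by rewrite divr_gt0.
have [N hN] := hxi _ d20.
exists N.+1 => -[//|n]; rewrite ltnS => Nn _ [y Iy <-].
have -> : prefix_word (fun n => if n is m.+1 then xi m else i) n.+1 =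
    i :: prefix_word xi n.
  rewrite /prefix_word /mkseq /=; congr (_ :: _).
  by rewrite -[1%N]/(1 + 0)%N iotaDl -map_comp.
apply: hd => /=; last exact: word_map_unit.
rewrite -ball_normE /=; apply: (@le_lt_trans _ _ (d / 2)).
  by apply: (hN n) => //; exists y.
by rewrite ltr_pdivrMr// ltr_pMr// ltr1n.
Qed.

Lemma target_word_image x (e : R) : target T x -> 0 < e ->
  exists2 s, s <> [::] & forall y, word_image T s y -> `|x - y| <= e.
Proof.
move=> /targetP[xi h] /h[N hN]; exists (prefix_word xi N.+1) => //.
exact/hN/leqnSn.
Qed.

Lemma common_fixed_word x s : (forall i, T i x = x) -> word_map T s x = x.
Proof. by move=> h; elim: s => //= i s ->. Qed.

(** A common fixed point belongs to the image of every word. *)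
Lemma common_fixed_target x z : J01 z -> (forall i, T i z = z) -> target T x -> x = z.
Proof.
move=> Iz hz tx; apply/eqP; rewrite -subr_eq0 -normr_le0; apply/ler_addgt0Pl => e e0.
have [s _ hs] := target_word_image tx e0.
rewrite addr0; apply: hs; exists z => //; exact: common_fixed_word.
Qed.

(** * Two target points yield two words with disjoint images *)

Section interval_J.
Context (a b : R).
Hypotheses (a_ge0 : 0 <= a) (a_lt_b : a < b) (b_le1 : b <= 1).
Hypothesis T_J : forall i, T i @` `[a, b] `<=` `[a, b].
Hypothesis T_inj : forall i, set_inj `[a, b] (T i).

Lemma sub_J_unit : `[a, b] `<=` J01.
Proof.
move=> x; rewrite /unit_interval /= !in_itv /= => /andP[ax xb].
by rewrite (le_trans a_ge0)// (le_trans xb).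
Qed.

Lemma target_J x : target T x -> a <= x <= b.
Proof. by apply: target_itv => //; [exact: sub_J_unit|exact: ltW]. Qed.

(** Otherwise [a] and [b] are target points, and the maps, being injective on
    [a, b], permute them: both then lie in the image of every word, which
    contradicts the small images around a target point. *)
Lemma target_interior x y : target T x -> target T y -> x <> y ->
  exists2 z, target T z & a < z < b.
Proof.
move=> tx ty xy; apply: contrapT => h.
have ab z : target T z -> z = a \/ z = b.
  move=> tz; have /andP[az zb] := target_J tz.
  have [->|za] := eqVneq z a; first by left.
  have [->|zb'] := eqVneq z b; first by right.
  by case: h; exists z; rewrite // !lt_neqAle az zb eq_sym za zb'.
have [ta tb] : target T a /\ target T b.
  by case: (ab _ tx) => xE; case: (ab _ ty) => yE; move: tx ty xy; rewrite xE yE.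
have aJ : a \in `[a, b] by rewrite in_itv /= lexx ltW.
have bJ : b \in `[a, b] by rewrite in_itv /= lexx ltW.
have perm s : (word_map T s a = a /\ word_map T s b = b) \/
              (word_map T s a = b /\ word_map T s b = a).
  elim: s => [|i s IH] /=; first by left.
  have nab : T i a <> T i b.
    by move=> /(T_inj (mem_set aJ) (mem_set bJ)) e; move: a_lt_b; rewrite e ltxx.
  have := ab _ (target_invariant i ta); have := ab _ (target_invariant i tb).
  case: IH => -[-> ->]; case=> eb; case=> ea; move: nab; rewrite ?ea ?eb => //; auto.
have e0 : 0 < (b - a) / 3 by rewrite divr_gt0 ?subr_gt0.
have [s _ hs] := target_word_image ta e0.
have := hs b; have sb : word_image T s b.
  by case: (perm s) => -[ea eb]; [exists b|exists a] => //; exact: sub_J_unit.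
move=> /(_ sb); rewrite distrC ger0_norm; last by rewrite subr_ge0 ltW.
move=> ?; lra.
Qed.

(** A continuous injective map is strictly monotone, so the image of an interior
    point lies strictly between the images of the endpoints. *)
Lemma T_interior i z : a < z < b -> a < T i z < b.
Proof.
move=> /andP[az zb].
have Tc : {within `[a, b], continuous (T i)}.
  exact: continuous_subspaceW sub_J_unit (@T_cont i).
have inj : {in `[a, b] &, injective (T i)}.
  by move=> x y xJ yJ; apply: T_inj; rewrite inE.
have aJ : a \in `[a, b] by rewrite in_itv /= lexx ltW.
have bJ : b \in `[a, b] by rewrite in_itv /= lexx ltW.
have zJ : z \in `[a, b] by rewrite in_itv /= !ltW.
have TJ x : x \in `[a, b] -> a <= T i x <= b.
  move=> xJ; suff : T i x \in `[a, b] by rewrite in_itv.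
  by apply: (@T_J i); exists x.
have /andP[? ?] := TJ _ aJ; have /andP[? ?] := TJ _ bJ.
have nza : T i z != T i a by apply/eqP => /(inj _ _ zJ aJ) e; rewrite e ltxx in az.
have nzb : T i z != T i b by apply/eqP => /(inj _ _ zJ bJ) e; rewrite e ltxx in zb.
have [le|/ltW ge] := leP (T i a) (T i b).
  have mono := segment_continuous_inj_le le Tc inj.
  have h1 : T i a < T i z by rewrite lt_neqAle eq_sym nza (mono _ _ aJ zJ) ltW.
  have h2 : T i z < T i b by rewrite lt_neqAle nzb (mono _ _ zJ bJ) ltW.
  by apply/andP; split; lra.
have mono := segment_continuous_inj_ge ge Tc inj.
have h1 : T i z < T i a by rewrite lt_neqAle nza (mono _ _ zJ aJ) ltW.
have h2 : T i b < T i z by rewrite lt_neqAle eq_sym nzb (mono _ _ bJ zJ) ltW.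
by apply/andP; split; lra.
Qed.

(** The second interior target point is the image of the first one under a map
    that moves it. *)
Lemma two_targets_split x y : target T x -> target T y -> x <> y ->
  exists s t, [/\ s <> [::], t <> [::], word_image T s `&` word_image T t = set0
    & word_image T s `|` word_image T t `<=` `[a, b]].
Proof.
move=> tx ty xy; have [z tz zab] := target_interior tx ty xy.
have [i Tz] : exists i, T i z <> z.
  apply: contrapT => /forallNP h; apply: xy.
  have hz i : T i z = z by exact: contrapT.
  have Iz := target_unit tz.
  by rewrite (common_fixed_target Iz hz tx) (common_fixed_target Iz hz ty).
have zab' := T_interior i zab; have tz' := target_invariant i tz.
move: (T i z) Tz zab' tz' => z' zz' zab' tz'.
(* Two sets within a third of the distance of z and z' cannot meet. *)
have near u : target T u -> a < u < b -> exists s, [/\ s <> [::],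
    word_image T s `<=` `[a, b] &
    forall v, word_image T s v -> `|u - v| <= `|z - z'| / 3].
  move=> tu /andP[au ub].
  pose e := Num.min (`|z - z'| / 3) (Num.min (u - a) (b - u)).
  have e0 : 0 < e.
    rewrite !lt_min !subr_gt0 au ub !andbT divr_gt0// normr_gt0 subr_eq0.
    by apply/eqP => /esym.
  have [s s0 hs] := target_word_image tu e0; exists s; split=> // v /hs.
    rewrite !le_min => /and3P[_]; rewrite !ler_norml /= in_itv /= => /andP[? ?] /andP[? ?].
    by apply/andP; split; lra.
  by rewrite le_min => /andP[].
have [s [s0 sJ hs]] := near z tz zab; have [t [t0 tJ ht]] := near z' tz' zab'.
exists s, t; split=> //; last by move=> v [/sJ|/tJ].
rewrite -subset0 => v [/hs h1 /ht h2].
have : `|z - z'| <= `|z - z'| / 3 + `|z - z'| / 3.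
  rewrite -{1}(subrK v z) -addrA (le_trans (ler_normD _ _))// lerD//.
  by rewrite distrC.
have : 0 < `|z - z'| by rewrite normr_gt0 subr_eq0; apply/eqP => /esym.
move=> *; lra.
Qed.

End interval_J.
End target.

(** * The equivalence *)

Theorem theorem4p10 (R : realType) (k : nat) (T : 'I_k.+2 -> R -> R)
    (T_cont : forall i, {within unit_interval R, continuous (T i)})
    (T_unit : forall i, T i @` unit_interval R `<=` unit_interval R)
    (a b : R) (a_ge0 : 0 <= a) (a_lt_b : a < b) (b_le1 : b <= 1)
    (T_J : forall i, T i @` `[a, b] `<=` `[a, b])
    (T_inj : forall i, set_inj `[a, b] (T i)) :
  [<-> no_common_fixed_point T /\ weakly_hyperbolic T !=set0;
       exists x y, [/\ target T x, target T y & x <> y];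
       exists xi omega : seq 'I_k.+2,
         [/\ xi <> [::], omega <> [::],
             (word_map T xi @` unit_interval R)
               `&` (word_map T omega @` unit_interval R) = set0 &
             (word_map T xi @` unit_interval R)
               `|` (word_map T omega @` unit_interval R) `<=` `[a, b]];
       no_common_fixed_point T /\
       forall mu : probability (borel_shift_space k.+1) R,
         markov_measure mu -> mixing mu -> measure_support mu = setT ->
         mu (weakly_hyperbolic T) = 1%E].
Proof.
tfae.
- move=> [nofix [xi hxi]]; have tx : target T (coding T xi) by exists xi.
  have [i nx] : exists i, T i (coding T xi) <> coding T xi.
    apply: contrapT => /forallNP h; apply: nofix.
    by exists (coding T xi) => [|i]; [exact: target_unit tx|exact: contrapT].
  exists (T i (coding T xi)), (coding T xi); split=> //.
  exact: target_invariant.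
- by move=> [x [y [tx ty xy]]]; apply: two_targets_split tx ty xy.
- move=> [u [v [_ _ disj sub]]]; split.
    move=> [x Ix fx]; suff : set0 x by [].
    by rewrite -disj; split; exists x => //; exact: common_fixed_word.
  by move=> mu markov_mu _ full_mu; exact: weakly_hyperbolic_full disj sub.
- move=> [nofix full]; split=> //; apply/set0P/eqP => S0.
  have := full _ (markov_bernoulli_shift R k.+1) (@mixing_bernoulli_shift R k.+1)
    (measure_support_bernoulli_shift R k.+1).
  by rewrite S0 measure0 => /esym/eqP; rewrite onee_eq0.
Qed.
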